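(* Let $X=(X_1, X_2\rightrightarrows\mathcal C_{X_1})$ be generating data and let $C$ be a set of conditions on $X$. There exists a unique (up to isomorphism) $\mathcal F_{X/C}\in p_2Cat$ satisfying: 1. There is a map $G:\mathcal F_X\to\mathcal F_{X/C}$ in $p_2Cat$ such that for all $x,y\in\mathcal F_X$, $xCy$ implies $G(x)=G(y)$. 2. $\mathcal F_{X/C}$ is universal among pre-2-categories $D$ equipped with a map $\mathcal F_X\to D$ in $p_2Cat$ that takes equal values on $x$ and $y$ whenever $x,y\in\mathcal F_X$ and $xCy$, in the sense that for any other map $F:\mathcal F_X\to D$ in $p_2Cat$ for which $xCy$ implies $F(x)=F(y)$ for all $x,y\in\mathcal F_X$, $F$ factors uniquely through $G$ in $p_2Cat$, i.e. there is a unique map $H:\mathcal F_{X/C}\to D$ in $p_2Cat$ with $HG=F$.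
   Context: Everything is small. For $n\ge 0$, an *$n$-categorically graded set* is a set $S$ with maps $s_i,t_i : S \to S$ for $0\le i<n$ such that, whenever $\sigma_i,\rho_i \in \{s_i,t_i\}$: (i) $\rho_i\sigma_i = \sigma_i$ for all $i$; (ii) for all $i<j$ and $\sigma_i\in\{s_i,t_i\}$, $\rho_j\in\{s_j,t_j\}$, $\rho_j\sigma_i=\sigma_i$ and $\sigma_i\rho_j=\sigma_i$. Morphisms are functions preserving all $s_i,t_i$; this gives the category $gr_nCat$. A *pre-$n$-category* is an $n$-categorically graded set $\mathcal A$ together with compositions $*_i : \{(a,b)\in\mathcal A\times\mathcal A : s_i a = t_i b\}\to\mathcal A$ for $0\le i\le n-1$ such that $s_i(a*_i b)=s_i b$, $t_i(a*_i b)=t_i a$, and for $i<j$ and $\rho_j\in\{s_j,t_j\}$, $\rho_j(a*_i b)=\rho_j a *_i \rho_j b$. (No associativity, unit or interchange laws are required.) Morphisms are functions preserving all $s_i,t_i,*_i$; this gives the category $p_nCat$. *Free pre-1-category.* For $X_1\in gr_1Cat$, $\mathcal C_{X_1}\in p_1Cat$ is the pre-1-category of fully parenthesized composable formal words in $X_1$: $S_1=X_1$, $S_n=\bigsqcup_{1\le p\le n-1}\{x\bullet_0 y : x\in S_p,\ y\in S_{n-p},\ s_0x=t_0y\}$, $\mathcal C_{X_1}=\bigsqcup_{n\ge1}S_n$, with $s_0(x\bullet_0y)=s_0y$, $t_0(x\bullet_0y)=t_0x$ and $x*_0y=x\bullet_0y$. *Generating data* $X=(X_1,X_2\rightrightarrows\mathcal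 C_{X_1})$ consists of $X_1\in gr_1Cat$ and a set $X_2$ with maps of sets $s_1,t_1:X_2\to\mathcal C_{X_1}$ such that $\sigma_0s_1=\sigma_0t_1$ for $\sigma_0\in\{s_0,t_0\}$. Write $\mathcal C=\mathcal C_{X_1}$. The disjoint union $X_2\cup\mathcal C$ is a 2-categorically graded set with $s_1=t_1=\mathrm{id}$ on $\mathcal C$ and $\sigma_0:=\sigma_0s_1$ on $X_2$. *The pre-2-category $\mathcal F_X$ generated by $X$* is $\bigsqcup_{n\ge1}T_n$, where $T_1=X_2\sqcup\mathcal C$, $T_2$ is the set of formal words $x\bullet_iy$ with $i\in\{0,1\}$, $x,y\in T_1$, $s_ix=t_iy$, excluding words $x\bullet_0y$ with $x,y\in\mathcal C$, and for $n>2$, $T_n=\bigsqcup_{0<p<n}\{x\bullet_iy: i\in\{0,1\}, x\in T_p,y\in T_{n-p},s_ix=t_iy\}$. Its structure is $s_i(x\bullet_iy)=s_iy$, $t_i(x\bullet_iy)=t_ix$, $s_0(x\bullet_1y)=s_0y$, $t_0(x\bullet_1y)=t_0x$, $\sigma_1(x\bullet_0y)=\sigma_1x*_0\sigma_1y$ for $\sigma_1\in\{s_1,t_1\}$; $x*_1y=x\bullet_1y$; and $x*_0y$ is the composite in $\mathcal C$ if $x,y\in\mathcal C$, and $x\bullet_0y$ otherwise. A *set of conditions* on $X$ is a binary relation $C$ on (the underlying set of) $\mathcal F_X$. *)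

(* Defs.v *)
From mathcomp Require Import all_boot.
From mathcomp Require Import boolp.

Set Implicit Arguments.
Unset Strict Implicit.
Unset Printing Implicit Defensive.

(* [bd Src i] is s_i and [bd Tgt i] is t_i; letters such as sigma_i in
   {s_i, t_i} become quantification over [side]. *)
Inductive side := Src | Tgt.

Record grCat (n : nat) := GrCat {
  gr_sort :> Type;
  bd : side -> 'I_n -> gr_sort -> gr_sort;
  bd_bd : forall (r s : side) (i : 'I_n) (x : gr_sort),
    bd r i (bd s i x) = bd s i x;
  bd_gt : forall (r s : side) (i j : 'I_n) (x : gr_sort), i < j ->
    bd r j (bd s i x) = bd s i x;
  bd_lt : forall (r s : side) (i j : 'I_n) (x : gr_sort), i < j ->
    bd s i (bd r j x) = bd s i x
}.

Record grHom (n : nat) (A B : grCat n) := GrHom {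
  gr_fun :> A -> B;
  gr_fun_bd : forall (r : side) (i : 'I_n) (x : A),
    gr_fun (bd r i x) = bd r i (gr_fun x)
}.

Definition composable (n : nat) (A : grCat n) (i : 'I_n) (a b : A) : Prop :=
  bd Src i a = bd Tgt i b.

Lemma composable_bd (n : nat) (A : grCat n) (r : side) (i j : 'I_n) (a b : A) :
  i < j -> composable i a b -> composable i (bd r j a) (bd r j b).
Proof. by move=> ij h; rewrite /composable !bd_lt. Qed.

Lemma composable_hom (n : nat) (A B : grCat n) (f : grHom A B) (i : 'I_n)
    (a b : A) : composable i a b -> composable i (f a) (f b).
Proof. by move=> h; rewrite /composable -!gr_fun_bd h. Qed.

Record preCat (n : nat) := PreCat {
  pre_gr :> grCat n;
  pcomp : forall (i : 'I_n) (a b : pre_gr), composable i a b -> pre_gr;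
  src_pcomp : forall (i : 'I_n) (a b : pre_gr) (h : composable i a b),
    bd Src i (pcomp h) = bd Src i b;
  tgt_pcomp : forall (i : 'I_n) (a b : pre_gr) (h : composable i a b),
    bd Tgt i (pcomp h) = bd Tgt i a;
  bd_pcomp : forall (r : side) (i j : 'I_n) (a b : pre_gr) (ij : i < j)
    (h : composable i a b),
    bd r j (pcomp h) = pcomp (composable_bd r ij h)
}.

Record preHom (n : nat) (A B : preCat n) := PreHom {
  pre_fun :> grHom A B;
  pre_fun_pcomp : forall (i : 'I_n) (a b : A) (h : composable i a b),
    pre_fun (pcomp h) = pcomp (composable_hom pre_fun h)
}.

Section Category.
Variable n : nat.

Definition grHom_id (A : grCat n) : grHom A A :=
  @GrHom n A A (fun x => x) (fun _ _ _ => erefl).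

Lemma preHom_id_subproof (A : preCat n) (i : 'I_n) (a b : A)
    (h : composable i a b) :
  grHom_id A (pcomp h) = pcomp (composable_hom (grHom_id A) h).
Proof. by congr pcomp; apply: Prop_irrelevance. Qed.

Definition preHom_id (A : preCat n) : preHom A A :=
  PreHom (@preHom_id_subproof A).

Lemma grHom_comp_subproof (A B D : grCat n) (g : grHom B D) (f : grHom A B)
    (r : side) (i : 'I_n) (x : A) :
  g (f (bd r i x)) = bd r i (g (f x)).
Proof. by rewrite !gr_fun_bd. Qed.

Definition grHom_comp (A B D : grCat n) (g : grHom B D) (f : grHom A B) :
  grHom A D := GrHom (grHom_comp_subproof g f).

Lemma preHom_comp_subproof (A B D : preCat n) (g : preHom B D)
    (f : preHom A B) (i : 'I_n) (a b : A) (h : composable i a b) :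
  grHom_comp g f (pcomp h) = pcomp (composable_hom (grHom_comp g f) h).
Proof.
rewrite /= !pre_fun_pcomp; congr pcomp; exact: Prop_irrelevance.
Qed.

Definition preHom_comp (A B D : preCat n) (g : preHom B D) (f : preHom A B) :
  preHom A D := PreHom (preHom_comp_subproof g f).

Definition is_iso (A B : preCat n) (f : preHom A B) : Prop :=
  exists g : preHom B A,
    preHom_comp g f = preHom_id A /\ preHom_comp f g = preHom_id B.

End Category.

Lemma sval_inj (T : Type) (P : T -> Prop) (a b : {x | P x}) :
  sval a = sval b -> a = b.
Proof.
case: a b => [x px] [y py] /= e; subst y; congr exist; exact: Prop_irrelevance.
Qed.

Section FreePre1.
Variable X1 : grCat 1.

(* Parenthesized words are binary trees carved out by the composability
   predicate [wf1]: S_n is the set of well-formed trees with n leaves. The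
   boundaries s_0, t_0 always land in S_1 = X_1, so they are first computed
   on all trees, by [end1]. *)
Inductive word1 :=
  | Gen1 (x : X1)
  | Comp1 (u v : word1).

Fixpoint end1 (r : side) (w : word1) : X1 :=
  match w with
  | Gen1 x => bd r ord0 x
  | Comp1 u v => match r with Src => end1 Src v | Tgt => end1 Tgt u end
  end.

Fixpoint wf1 (w : word1) : Prop :=
  match w with
  | Gen1 _ => True
  | Comp1 u v => [/\ wf1 u, wf1 v & end1 Src u = end1 Tgt v]
  end.

Definition free1_sort := {w : word1 | wf1 w}.

Definition free1_bd (r : side) (i : 'I_1) (w : free1_sort) : free1_sort :=
  exist wf1 (Gen1 (end1 r (sval w))) I.

Lemma end1_bd (r s : side) (w : word1) : bd r ord0 (end1 s w) = end1 s w.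
Proof. by elim: w s => [x|u IHu v IHv] [] /=; rewrite ?bd_bd. Qed.

Lemma free1_bd_bd (r s : side) (i : 'I_1) (w : free1_sort) :
  free1_bd r i (free1_bd s i w) = free1_bd s i w.
Proof. by apply: sval_inj; rewrite /= end1_bd. Qed.

Lemma free1_bd_gt (r s : side) (i j : 'I_1) (w : free1_sort) : i < j ->
  free1_bd r j (free1_bd s i w) = free1_bd s i w.
Proof. by rewrite !ord1. Qed.

Lemma free1_bd_lt (r s : side) (i j : 'I_1) (w : free1_sort) : i < j ->
  free1_bd s i (free1_bd r j w) = free1_bd s i w.
Proof. by rewrite !ord1. Qed.

Definition free1_gr : grCat 1 := GrCat free1_bd_bd free1_bd_gt free1_bd_lt.

Lemma free1_pcomp_wf (i : 'I_1) (a b : free1_gr) (h : composable i a b) :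
  wf1 (Comp1 (sval a) (sval b)).
Proof.
by split; [exact: svalP a | exact: svalP b | move: (congr1 sval h) => [->]].
Qed.

Definition free1_pcomp (i : 'I_1) (a b : free1_gr) (h : composable i a b) :
  free1_gr := exist wf1 (Comp1 (sval a) (sval b)) (free1_pcomp_wf h).

Lemma free1_src_pcomp (i : 'I_1) (a b : free1_gr) (h : composable i a b) :
  bd Src i (free1_pcomp h) = bd Src i b.
Proof. exact: sval_inj. Qed.

Lemma free1_tgt_pcomp (i : 'I_1) (a b : free1_gr) (h : composable i a b) :
  bd Tgt i (free1_pcomp h) = bd Tgt i a.
Proof. exact: sval_inj. Qed.

Lemma free1_bd_pcomp (r : side) (i j : 'I_1) (a b : free1_gr) (ij : i < j)
    (h : composable i a b) :
  bd r j (free1_pcomp h) = free1_pcomp (composable_bd r ij h).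
Proof. by exfalso; move: ij; rewrite !ord1. Qed.

Definition free1 : preCat 1 :=
  PreCat free1_src_pcomp free1_tgt_pcomp free1_bd_pcomp.

End FreePre1.

Record genData := GenData {
  gen1 : grCat 1;
  gen2 : Type;
  gen2_bd : side -> gen2 -> free1 gen1;
  gen2_glob : forall (r : side) (x : gen2),
    bd r ord0 (gen2_bd Src x) = bd r ord0 (gen2_bd Tgt x)
}.

Section FreePre2.
Variable X : genData.

(* Again trees carved out by a predicate. [Cell] and [Word] are the two
   summands of T_1; a [Word] is required to be well-formed only in [wf2], so
   that the composite of s_1-boundaries, hence [end2], is total on trees. *)
Inductive word2 :=
  | Cell (x : gen2 X)
  | Word (c : word1 (gen1 X))
  | Comp2 (i : 'I_2) (u v : word2).

(* All boundaries of elements of F_X lie in C. For [Comp2 j u v] the case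
   [j < i] is i = 1, j = 0. *)
Fixpoint end2 (r : side) (i : 'I_2) (w : word2) : word1 (gen1 X) :=
  match w with
  | Cell x => if i == ord0 then Gen1 (end1 r (sval (gen2_bd Src x)))
              else sval (gen2_bd r x)
  | Word c => if i == ord0 then Gen1 (end1 r c) else c
  | Comp2 j u v =>
      if j < i then Comp1 (end2 r i u) (end2 r i v)
      else match r with Src => end2 Src i v | Tgt => end2 Tgt i u end
  end.

Definition is_word (w : word2) : bool := if w is Word _ then true else false.

Fixpoint wf2 (w : word2) : Prop :=
  match w with
  | Cell _ => True
  | Word c => wf1 c
  | Comp2 i u v =>
      [/\ wf2 u, wf2 v, end2 Src i u = end2 Tgt i v &
          ~~ [&& i == ord0, is_word u & is_word v]]
  end.

Definition comp2 (i : 'I_2) (u v : word2) : word2 :=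
  match u, v with
  | Word c, Word d => if i == ord0 then Word (Comp1 c d) else Comp2 i u v
  | _, _ => Comp2 i u v
  end.

Lemma ord2P (i : 'I_2) : i = ord0 \/ i = ord_max.
Proof. by case: i => [[|[|//]] h]; [left | right]; apply: val_inj. Qed.

Lemma end2_0 (r : side) (w : word2) :
  exists x, end2 r ord0 w = Gen1 x /\ forall s, bd s ord0 x = x.
Proof.
elim: w r => [x|c|j u IHu v IHv] r; rewrite /= ?eqxx.
- by eexists; split; [reflexivity|move=> s; rewrite end1_bd].
- by eexists; split; [reflexivity|move=> s; rewrite end1_bd].
- by case: r; [exact: IHv | exact: IHu].
Qed.

Lemma end2_01 (r s : side) (w : word2) : wf2 w ->
  Gen1 (end1 s (end2 r ord_max w)) = end2 s ord0 w.
Proof.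
elim: w r s => [x|c|j u IHu v IHv] r s //=.
- move=> _; case: r => //; congr Gen1.
  by have /(congr1 sval) [->] := gen2_glob s x.
- case=> wu wv e _; case: (ord2P j) e => -> e /=.
    by case: s => /=; [exact: IHv | exact: IHu].
  case: r; case: s; rewrite ?IHu ?IHv //.
  + by rewrite -(IHv Tgt Tgt wv) -e IHu.
  + by rewrite -(IHu Src Src wu) e IHv.
Qed.

Lemma end2_wf (r : side) (i : 'I_2) (w : word2) : wf2 w -> wf1 (end2 r i w).
Proof.
elim: w r => [x|c|j u IHu v IHv] r /=.
- by case: ifP => // _ _; exact: svalP (gen2_bd r x).
- by case: ifP.
- case=> wu wv e _; case: ifP => ji; last by case: r; auto.
  split; [exact: IHu | exact: IHv |].
  case: (ord2P i) (ord2P j) ji e => -> [] -> //= _ e.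
  by have := e; rewrite -(end2_01 r _ wu) -(end2_01 r _ wv) => -[].
Qed.

Lemma end2_comp2 (r : side) (i j : 'I_2) (u v : word2) :
  end2 r i (comp2 j u v) = end2 r i (Comp2 j u v).
Proof.
case: u v => [?|c|? ? ?] [?|d|? ? ?] //=.
by case: (ord2P i) (ord2P j) => -> [] -> //=; case: r.
Qed.

Lemma comp2_wf (i : 'I_2) (u v : word2) :
  wf2 u -> wf2 v -> end2 Src i u = end2 Tgt i v -> wf2 (comp2 i u v).
Proof.
case: u v => [?|c|? ? ?] [?|d|? ? ?] wu wv e //=; try by split; rewrite // andbF.
case: ifP e => [/eqP ->|i0] /= e; first by case: e.
by split; rewrite // i0.
Qed.

Definition free2_sort := {w : word2 | wf2 w}.

Definition free2_bd (r : side) (i : 'I_2) (w : free2_sort) : free2_sort :=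
  exist wf2 (Word (end2 r i (sval w))) (end2_wf r i (svalP w)).

Lemma free2_bd_bd (r s : side) (i : 'I_2) (w : free2_sort) :
  free2_bd r i (free2_bd s i w) = free2_bd s i w.
Proof.
apply: sval_inj => /=; case: (ord2P i) => -> //=.
by have [x [-> xb]] := end2_0 s (sval w); rewrite /= xb.
Qed.

Lemma free2_bd_gt (r s : side) (i j : 'I_2) (w : free2_sort) : i < j ->
  free2_bd r j (free2_bd s i w) = free2_bd s i w.
Proof. by case: (ord2P i) (ord2P j) => -> [] -> // _; apply: sval_inj. Qed.

Lemma free2_bd_lt (r s : side) (i j : 'I_2) (w : free2_sort) : i < j ->
  free2_bd s i (free2_bd r j w) = free2_bd s i w.
Proof.
case: (ord2P i) (ord2P j) => -> [] -> // _; apply: sval_inj => /=.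
by rewrite end2_01 //; exact: svalP w.
Qed.

Definition free2_gr : grCat 2 := GrCat free2_bd_bd free2_bd_gt free2_bd_lt.

Lemma composable_end2 (i : 'I_2) (a b : free2_gr) :
  composable i a b -> end2 Src i (sval a) = end2 Tgt i (sval b).
Proof. by move=> /(congr1 sval) []. Qed.

Definition free2_pcomp (i : 'I_2) (a b : free2_gr) (h : composable i a b) :
  free2_gr :=
  exist wf2 (comp2 i (sval a) (sval b))
    (comp2_wf (svalP a) (svalP b) (composable_end2 h)).

Lemma free2_src_pcomp (i : 'I_2) (a b : free2_gr) (h : composable i a b) :
  bd Src i (free2_pcomp h) = bd Src i b.
Proof.
by apply: sval_inj; rewrite /= end2_comp2 /= ltnn.
Qed.

Lemma free2_tgt_pcomp (i : 'I_2) (a b : free2_gr) (h : composable i a b) :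
  bd Tgt i (free2_pcomp h) = bd Tgt i a.
Proof.
by apply: sval_inj; rewrite /= end2_comp2 /= ltnn.
Qed.

Lemma free2_bd_pcomp (r : side) (i j : 'I_2) (a b : free2_gr) (ij : i < j)
    (h : composable i a b) :
  bd r j (free2_pcomp h) = free2_pcomp (composable_bd r ij h).
Proof.
apply: sval_inj; rewrite /= end2_comp2 /= ij.
by case: (ord2P i) (ord2P j) ij => -> [] ->.
Qed.

Definition free2 : preCat 2 :=
  PreCat free2_src_pcomp free2_tgt_pcomp free2_bd_pcomp.

End FreePre2.

Definition conditions (X : genData) := free2 X -> free2 X -> Prop.

Definition respects (X : genData) (C : conditions X) (D : preCat 2)
    (F : preHom (free2 X) D) : Prop :=
  forall x y : free2 X, C x y -> F x = F y.

Definition is_universal (X : genData) (C : conditions X) (Q : preCat 2)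
    (G : preHom (free2 X) Q) : Prop :=
  respects C G /\
  forall (D : preCat 2) (F : preHom (free2 X) D), respects C F ->
    exists! H : preHom Q D, preHom_comp H G = F.

(* Main.v *)
From mathcomp Require Import all_boot.
From mathcomp Require Import boolp.
Require Import Defs.

Set Implicit Arguments.
Unset Strict Implicit.
Unset Printing Implicit Defensive.

(** The set-theoretic quotient of F_X by the congruence generated by C is in
    general not a pre-category: two classes may become composable although no
    two of their representatives are, so formal composites must be adjoined,
    which may in turn become composable or equal, and so on.

    Instead, F_{X/C} is cut out of the product of all the pre-categories D
    under F_X, along maps F that identify C-related elements. It should be the
    part of that product generated by the image of F_X. The product is too
    large to be an object, but each of its generated elements is named by a
    formal [term] built from elements of F_X with boundary and composition
    symbols. A term has at most one value along a given F ([denotes]), and none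
    if it asks for a composite of non-composable elements. Take the terms that
    have a value along every F, modulo having the same value along every F
    ([agree]). As [agree] is a proposition, it may quantify over all D while its
    classes still form a small type.

    Every law of pre-categories holds in the quotient because it holds in each D.
    In particular two classes are composable exactly when their values are
    composable in every D, and then the formal composite has a value in every D.
    Evaluation along F factors F through the quotient, and the factorization is
    unique because every class is obtained from the image of F_X by boundaries
    and compositions ([quo_map_unique]). The construction takes an arbitrary
    pre-n-category A in place of F_X.

    Uniqueness up to isomorphism is the usual argument: the two mutual
    factorizations are inverse to each other because an endomorphism of a
    universal quotient that fixes the projection is the identity
    ([universal_endo_id]). *)

(** * Equality of composites and of morphisms *)

Lemma pcomp_congr (n : nat) (A : preCat n) (i : 'I_n) (a a' b b' : A)
    (h : composable i a b) (h' : composable i a' b') :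
  a = a' -> b = b' -> pcomp h = pcomp h'.
Proof.
by move=> ea eb; subst a' b'; congr pcomp; exact: Prop_irrelevance.
Qed.

Lemma preHom_ext (n : nat) (A B : preCat n) (f g : preHom A B) :
  (forall x, f x = g x) -> f = g.
Proof.
case: f g => [[f fb] fc] [[g gb] gc] /= /funext e; subst g.
have e : fb = gb by exact: Prop_irrelevance.
by subst gb; congr PreHom; exact: Prop_irrelevance.
Qed.

(** * Formal terms and their values *)

Section Quotient.
Variables (n : nat) (A : preCat n) (C : A -> A -> Prop).

Definition identifies (D : preCat n) (F : preHom A D) : Prop :=
  forall x y : A, C x y -> F x = F y.

Inductive term :=
  | Gen (x : A)
  | Bd (r : side) (i : 'I_n) (t : term)
  | Comp (i : 'I_n) (u v : term).

(** Evaluation is a relation because [pcomp] is partial. *)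
Fixpoint denotes (D : preCat n) (F : preHom A D) (t : term) (d : D) : Prop :=
  match t with
  | Gen x => F x = d
  | Bd r i u => exists2 e, denotes F u e & bd r i e = d
  | Comp i u v => exists a b (h : composable i a b),
      [/\ denotes F u a, denotes F v b & pcomp h = d]
  end.

Lemma denotes_fun (D : preCat n) (F : preHom A D) (t : term) (d d' : D) :
  denotes F t d -> denotes F t d' -> d = d'.
Proof.
elim: t d d' => [x|r i u IH|i u IHu v IHv] d d' /=.
- by move=> <-.
- by case=> e ue <- [e' ue' <-]; rewrite (IH _ _ ue ue').
- case=> [a [b [h [ua vb <-]]]] [a' [b' [h' [ua' vb' <-]]]].
  by apply: pcomp_congr; [exact: IHu ua ua' | exact: IHv vb vb'].
Qed.

(** A partial equivalence relation: [agree t t] says that t has a value along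
    every admissible map. *)
Definition agree (t u : term) : Prop :=
  forall (D : preCat n) (F : preHom A D), identifies F ->
  exists2 d, denotes F t d & denotes F u d.

Lemma agree_sym (t u : term) : agree t u -> agree u t.
Proof. by move=> tu D F /tu [d td ud]; exists d. Qed.

Lemma agree_trans (t u v : term) : agree t u -> agree u v -> agree t v.
Proof.
move=> tu uv D F FC; have [d td ud] := tu D F FC.
have [e ue ve] := uv D F FC.
by exists d; rewrite // (denotes_fun ud ue).
Qed.

Lemma agree_Bd (r : side) (i : 'I_n) (t u : term) :
  agree t u -> agree (Bd r i t) (Bd r i u).
Proof. by move=> tu D F /tu [d td ud]; exists (bd r i d); exists d. Qed.

Lemma agree_Comp (i : 'I_n) (t t' u u' : term) :
  agree (Bd Src i t) (Bd Tgt i u) -> agree t t' -> agree u u' ->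
  agree (Comp i t u) (Comp i t' u').
Proof.
move=> tu tt' uu' D F FC.
have [_ [a ta <-] [b ub ab]] := tu D F FC.
have h : composable i a b by rewrite /composable ab.
have [a' ta' t'a] := tt' D F FC; have [b' ub' u'b] := uu' D F FC.
rewrite -(denotes_fun ta ta') in t'a; rewrite -(denotes_fun ub ub') in u'b.
by exists (pcomp h); exists a, b, h.
Qed.

(** The three lemmas below are used in the inductive steps of
    [quo_map_unique]: a term has a value only if its immediate subterms do and
    its compositions are between composable values. *)
Lemma agree_Bd_inv (r : side) (i : 'I_n) (t : term) :
  agree (Bd r i t) (Bd r i t) -> agree t t.
Proof. by move=> tt D F /tt [_ [e te _] _]; exists e. Qed.

Lemma agree_Comp_inv (i : 'I_n) (u v : term) :
  agree (Comp i u v) (Comp i u v) -> agree u u /\ agree v v.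
Proof.
by move=> tt; split=> D F /tt [_ [a [b [h [ua vb _]]]] _]; [exists a | exists b].
Qed.

Lemma agree_Comp_composable (i : 'I_n) (u v : term) :
  agree (Comp i u v) (Comp i u v) -> agree (Bd Src i u) (Bd Tgt i v).
Proof.
move=> tt D F /tt [_ [a [b [h [ua vb _]]]] _].
by exists (bd Src i a); [exists a | exists b].
Qed.

(** * The quotient pre-category *)

Definition quo_sort := {P : term -> Prop | exists2 t, agree t t & P = agree t}.

Definition cls (t : term) (h : agree t t) : quo_sort :=
  exist _ (agree t)
    (ex_intro2 (fun u => agree u u) (fun u => agree t = agree u) t h erefl).

Lemma cls_eq (t u : term) (ht : agree t t) (hu : agree u u) :
  agree t u -> cls ht = cls hu.
Proof.
move=> tu; apply: sval_inj => /=; apply/funext => v; apply/propext.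
by split=> [tv|uv]; [exact: agree_trans (agree_sym tu) tv | exact: agree_trans uv].
Qed.

Definition repr (q : quo_sort) : term := s2val (cid2 (svalP q)).

Lemma repr_agree (q : quo_sort) : agree (repr q) (repr q).
Proof. exact: s2valP (cid2 (svalP q)). Qed.

Lemma reprK (q : quo_sort) : cls (repr_agree q) = q.
Proof. by apply: sval_inj; rewrite /= -(s2valP' (cid2 (svalP q))). Qed.

Lemma repr_cls (t : term) (h : agree t t) : agree (repr (cls h)) t.
Proof.
apply: agree_sym.
have /(congr1 (@^~ (repr (cls h)))) /= <- := congr1 sval (reprK (cls h)).
exact: repr_agree.
Qed.

Definition quo_bd (r : side) (i : 'I_n) (q : quo_sort) : quo_sort :=
  cls (agree_Bd r i (repr_agree q)).

Lemma repr_bd (r : side) (i : 'I_n) (q : quo_sort) :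
  agree (repr (quo_bd r i q)) (Bd r i (repr q)).
Proof. exact: repr_cls. Qed.

Lemma quo_bd_bd (r s : side) (i : 'I_n) (q : quo_sort) :
  quo_bd r i (quo_bd s i q) = quo_bd s i q.
Proof.
apply: cls_eq; apply: agree_trans (agree_Bd r i (repr_bd s i q)) _.
move=> D F /(repr_agree q) [d qd _]; exists (bd s i d); last by exists d.
by exists (bd s i d); [exists d | exact: bd_bd].
Qed.

Lemma quo_bd_gt (r s : side) (i j : 'I_n) (q : quo_sort) : i < j ->
  quo_bd r j (quo_bd s i q) = quo_bd s i q.
Proof.
move=> ij; apply: cls_eq; apply: agree_trans (agree_Bd r j (repr_bd s i q)) _.
move=> D F /(repr_agree q) [d qd _]; exists (bd s i d); last by exists d.
by exists (bd s i d); [exists d | exact: bd_gt].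
Qed.

Lemma quo_bd_lt (r s : side) (i j : 'I_n) (q : quo_sort) : i < j ->
  quo_bd s i (quo_bd r j q) = quo_bd s i q.
Proof.
move=> ij; apply: cls_eq; apply: agree_trans (agree_Bd s i (repr_bd r j q)) _.
move=> D F /(repr_agree q) [d qd _]; exists (bd s i d); last by exists d.
by exists (bd r j d); [exists d | exact: bd_lt].
Qed.

Definition quo_gr : grCat n := GrCat quo_bd_bd quo_bd_gt quo_bd_lt.

Lemma composable_repr (i : 'I_n) (p q : quo_gr) :
  composable i p q -> agree (Bd Src i (repr p)) (Bd Tgt i (repr q)).
Proof.
move=> h; apply: agree_trans (agree_sym (repr_bd Src i p)) _.
by rewrite [quo_bd _ _ _]h; exact: repr_bd.
Qed.

Definition quo_pcomp (i : 'I_n) (p q : quo_gr) (h : composable i p q) : quo_gr :=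
  cls (agree_Comp (composable_repr h) (repr_agree p) (repr_agree q)).

Lemma repr_pcomp (i : 'I_n) (p q : quo_gr) (h : composable i p q) :
  agree (repr (quo_pcomp h)) (Comp i (repr p) (repr q)).
Proof. exact: repr_cls. Qed.

Lemma composable_values (i : 'I_n) (p q : quo_gr) (h : composable i p q)
    (D : preCat n) (F : preHom A D) : identifies F ->
  exists a b, [/\ denotes F (repr p) a, denotes F (repr q) b & composable i a b].
Proof.
by move=> /(composable_repr h) [_ [a pa <-] [b qb ab]]; exists a, b.
Qed.

Lemma quo_src_pcomp (i : 'I_n) (p q : quo_gr) (h : composable i p q) :
  bd Src i (quo_pcomp h) = bd Src i q.
Proof.
apply: cls_eq; apply: agree_trans (agree_Bd Src i (repr_pcomp h)) _.
move=> D F /(composable_values h) [a [b [pa qb ab]]].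
exists (bd Src i b); last by exists b.
by exists (pcomp ab); [exists a, b, ab | exact: src_pcomp].
Qed.

Lemma quo_tgt_pcomp (i : 'I_n) (p q : quo_gr) (h : composable i p q) :
  bd Tgt i (quo_pcomp h) = bd Tgt i p.
Proof.
apply: cls_eq; apply: agree_trans (agree_Bd Tgt i (repr_pcomp h)) _.
move=> D F /(composable_values h) [a [b [pa qb ab]]].
exists (bd Tgt i a); last by exists a.
by exists (pcomp ab); [exists a, b, ab | exact: tgt_pcomp].
Qed.

Lemma quo_bd_pcomp (r : side) (i j : 'I_n) (p q : quo_gr) (ij : i < j)
    (h : composable i p q) :
  bd r j (quo_pcomp h) = quo_pcomp (composable_bd r ij h).
Proof.
apply: cls_eq; apply: agree_trans (agree_Bd r j (repr_pcomp h)) _.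
apply: agree_sym.
apply: (@agree_trans _ (Comp i (Bd r j (repr p)) (Bd r j (repr q)))).
  by apply: agree_Comp; [exact: composable_repr (composable_bd r ij h) |
    exact: repr_bd | exact: repr_bd].
move=> D F /(composable_values h) [a [b [pa qb ab]]].
exists (pcomp (composable_bd r ij ab)).
  by exists (bd r j a), (bd r j b), (composable_bd r ij ab);
    split=> //; [exists a | exists b].
by exists (pcomp ab); [exists a, b, ab | exact: bd_pcomp].
Qed.

Definition quo : preCat n := PreCat quo_src_pcomp quo_tgt_pcomp quo_bd_pcomp.

(** * The projection and its universal property *)

Lemma agree_Gen (x : A) : agree (Gen x) (Gen x).
Proof. by move=> D F _; exists (F x). Qed.

Definition proj (x : A) : quo := cls (agree_Gen x).

Lemma proj_bd (r : side) (i : 'I_n) (x : A) : proj (bd r i x) = bd r i (proj x).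
Proof.
apply: cls_eq; apply: agree_sym.
apply: agree_trans (agree_Bd r i (repr_cls (agree_Gen x))) _.
move=> D F _; exists (bd r i (F x)); first by exists (F x).
exact: gr_fun_bd.
Qed.

Definition proj_gr : grHom A quo := GrHom proj_bd.

Lemma proj_pcomp (i : 'I_n) (x y : A) (h : composable i x y) :
  proj_gr (pcomp h) = pcomp (composable_hom proj_gr h).
Proof.
apply: cls_eq; apply: agree_sym.
apply: (@agree_trans _ (Comp i (Gen x) (Gen y))).
  by apply: agree_Comp; [exact: composable_repr (composable_hom proj_gr h) |
    exact: repr_cls | exact: repr_cls].
move=> D F _; exists (pcomp (composable_hom F h)); last exact: pre_fun_pcomp.
by exists (F x), (F y), (composable_hom F h).
Qed.

Definition quo_proj : preHom A quo := PreHom proj_pcomp.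

Lemma quo_proj_identifies : identifies quo_proj.
Proof.
by move=> x y Cxy; apply: cls_eq => D F FC; exists (F x) => //=; rewrite (FC x y).
Qed.

Section Factorization.
Variables (D : preCat n) (F : preHom A D) (FC : identifies F).

Definition lift (q : quo) : D := s2val (cid2 (repr_agree q FC)).

Lemma lift_denotes (q : quo) : denotes F (repr q) (lift q).
Proof. exact: s2valP (cid2 (repr_agree q FC)). Qed.

Lemma lift_eq (q : quo) (t : term) (d : D) :
  agree (repr q) t -> denotes F t d -> lift q = d.
Proof.
move=> qt td; have [e qe te] := qt D F FC.
by rewrite (denotes_fun (lift_denotes q) qe) (denotes_fun te td).
Qed.

Lemma lift_bd (r : side) (i : 'I_n) (q : quo) : lift (bd r i q) = bd r i (lift q).
Proof.
by apply: lift_eq (repr_bd r i q) _; exists (lift q); first exact: lift_denotes.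
Qed.

Definition lift_gr : grHom quo D := GrHom lift_bd.

Lemma lift_pcomp (i : 'I_n) (p q : quo) (h : composable i p q) :
  lift_gr (pcomp h) = pcomp (composable_hom lift_gr h).
Proof.
apply: lift_eq (repr_pcomp h) _.
exists (lift p), (lift q), (composable_hom lift_gr h).
by split; [exact: lift_denotes | exact: lift_denotes |].
Qed.

Definition quo_lift : preHom quo D := PreHom lift_pcomp.

Lemma quo_lift_proj : preHom_comp quo_lift quo_proj = F.
Proof. by apply: preHom_ext => x; exact: lift_eq (repr_cls (agree_Gen x)) _. Qed.

End Factorization.

(** The projection is an epimorphism because its image generates [quo]; the
    induction runs over the terms that name classes. *)
Lemma quo_map_unique (D : preCat n) (H K : preHom quo D) :
  preHom_comp H quo_proj = preHom_comp K quo_proj -> H = K.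
Proof.
move=> HK; apply: preHom_ext => q; rewrite -(reprK q).
elim: (repr q) (repr_agree q) => {q} [x|r i u IH|i u IHu v IHv] h.
- have -> : cls h = quo_proj x by apply: cls_eq; exact: agree_Gen.
  by have := congr1 (fun f : preHom A D => f x) HK.
- have hu := agree_Bd_inv h.
  have -> : cls h = bd r i (cls hu : quo).
    by apply: cls_eq; apply: agree_Bd; exact: agree_sym (repr_cls hu).
  by rewrite !gr_fun_bd IH.
- have [hu hv] := agree_Comp_inv h; have huv := agree_Comp_composable h.
  have c : composable i (cls hu : quo) (cls hv).
    apply: cls_eq; apply: agree_trans (agree_Bd _ _ (repr_cls hu)) _.
    apply: agree_trans huv _.
    by apply: agree_Bd; exact: agree_sym (repr_cls hv).
  have -> : cls h = pcomp c.
    by apply: cls_eq; apply: agree_Comp huv _ _; exact: agree_sym (repr_cls _).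
  by rewrite !pre_fun_pcomp; exact: pcomp_congr.
Qed.

Lemma quo_universal (D : preCat n) (F : preHom A D) : identifies F ->
  exists! H : preHom quo D, preHom_comp H quo_proj = F.
Proof.
move=> FC; exists (quo_lift FC); split; first exact: quo_lift_proj.
by move=> K KF; apply: quo_map_unique; rewrite quo_lift_proj KF.
Qed.

End Quotient.

(** * Universal quotients of the free pre-2-category *)

Lemma universal_endo_id (X : genData) (C : conditions X) (Q : preCat 2)
    (G : preHom (free2 X) Q) (E : preHom Q Q) :
  is_universal C G -> preHom_comp E G = G -> E = preHom_id Q.
Proof.
case=> GC /(_ Q G GC) [H [_ uH]] EG.
by rewrite -(uH _ EG); apply: uH; exact: preHom_ext.
Qed.

Theorem theorem2p5 (X : genData) (C : conditions X) :
  (exists (Q : preCat 2) (G : preHom (free2 X) Q), is_universal C G) /\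
  (forall (Q Q' : preCat 2)
     (G : preHom (free2 X) Q) (G' : preHom (free2 X) Q'),
     is_universal C G -> is_universal C G' ->
     exists I : preHom Q Q', is_iso I /\ preHom_comp I G = G').
Proof.
split.
  exists (quo C), (quo_proj C).
  by split; [exact: quo_proj_identifies | exact: quo_universal].
move=> Q Q' G G' uG uG'.
have [I [IG _]] := uG.2 Q' G' uG'.1; have [J [JG' _]] := uG'.2 Q G uG.1.
exists I; split=> //; exists J; split.
- by apply: universal_endo_id uG _; rewrite -[RHS]JG' -IG; exact: preHom_ext.
- by apply: universal_endo_id uG' _; rewrite -[RHS]IG -JG'; exact: preHom_ext.
Qed.
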